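(* Let an increasing price function $P:\mathbb{N}_{\ge 1}\to\mathbb{R}_{\ge 0}$ such that basic zone tariffs with respect to $P$ satisfy the no-stopover property (i.e. $P(k)\le P(i)+P(k-i+1)$ for all $k\ge 1$, $1\le i\le k$), a metropolitan price $P_M\in\mathbb{R}_{\ge 0}$, and an integer $d\in\mathbb{N}_{\ge 1}$ be given. All zone tariffs with metropolitan zone with respect to $P$ and $P_M$ on a PTN with $D_{\max}=d$ satisfy the no-stopover property if and only if $P(d+k)\le P_M+P(k+1)$ for all $k\in\mathbb{N}_{\ge 1}$.
   Context: ''Increasing'' means non-decreasing. A PTN is a finite, simple, connected, undirected graph $(V,E)$. A path is a finite sequence $(x_1,\dots,x_n)$, $n\ge 1$, of (not necessarily distinct) nodes with consecutive nodes adjacent; $[x_i,x_j]$ denotes the subpath $(x_i,\dots,x_j)$. A zone partition $\mathcal{Z}$ is a partition of $V$ into nonempty sets called zones. The zone border weight of an edge $e=\{x,y\}$ is $b(e)=0$ if $x,y$ lie in the same zone and $b(e)=1$ otherwise; $z(W)=1+\sum_{i=1}^{n-1}b(x_i,x_{i+1})$ for a path $W=(x_1,\dots,x_n)$. The basic zone tariff with respect to $P$ is $W\mapsto P(z(W))$. A metropolitan zone is a union $Z_M=\bigcup_{Z\in\mathcal{Z}_M}Z$ for some $\mathcal{Z}_M\subseteq\mathcal{Z}$; it is assumed to contain at least one node and to be connected (its induced subgraph is connected). A path is included in $Z_M$ if all its nodes lie in $Z_M$. The zone tariff with metropolitan zone $Z_M$, price function $P$ and metropolitan price $P_M$ is the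 fare structure with $p(W)=P_M$ if $W$ is included in $Z_M$ and $p(W)=P(z(W))$ otherwise. The maximum metropolitan zone distance is $$D_{\max}=\max_{x,y\in Z_M}\ \min\{z(W): W \text{ an } x\text{-}y\text{-path included in } Z_M\}.$$ Standing assumption: passengers who travel within $Z_M$ use a path with a minimum number of zones; that is, only paths are considered for which every subpath $W'$ included in $Z_M$ satisfies $z(W')\le D_{\max}$. No-stopover property: $p([x_1,x_n])\le p([x_1,x_i])+p([x_i,x_n])$ for all (considered) paths $(x_1,\dots,x_n)$, $n\ge 3$, and all $i\in\{2,\dots,n-1\}$. *)

(* Defs.v *)
From mathcomp Require Import all_boot all_order all_algebra.
From mathcomp Require Import boolp reals.

Set Implicit Arguments.
Unset Strict Implicit.
Unset Printing Implicit Defensive.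

Import Order.TTheory GRing.Theory Num.Theory.

Record ptn := Ptn {
  node :> finType;
  adj : rel node;
  adj_sym : symmetric adj;
  adj_irr : irreflexive adj;
  adj_connected : forall x y, connect adj x y }.

(* Nodes may repeat along a path. *)
Definition is_path (G : ptn) (W : seq G) : bool :=
  (W != [::]) && sorted (@adj G) W.

(* [x_i, x_j] for W = (x_1, ..., x_n); indices start at 1. *)
Definition subpath (T : Type) (W : seq T) (i j : nat) : seq T :=
  drop i.-1 (take j W).

Record zone_partition (G : ptn) := ZonePartition {
  zones :> {set {set G}};
  zonesP : partition zones [set: G] }.

Definition border_weight (G : ptn) (Z : zone_partition G) (x y : G) : nat :=
  pblock Z x != pblock Z y.

(* zip W (behead W) lists the pairs (x_i, x_(i+1)) for 1 <= i < n. *)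
Definition zone_count (G : ptn) (Z : zone_partition G) (W : seq G) : nat :=
  1 + \sum_(e <- zip W (behead W)) border_weight Z e.1 e.2.

Record metro_zone (G : ptn) (Z : zone_partition G) := MetroZone {
  metro_zones : {set {set G}};
  metro_sub : metro_zones \subset zones Z;
  metro_neq0 : cover metro_zones != set0;
  metro_connected : forall x y, x \in cover metro_zones ->
    y \in cover metro_zones ->
    connect [rel u v in cover metro_zones | adj u v] x y }.

Section Metropolitan.
Variables (G : ptn) (Z : zone_partition G) (M : metro_zone Z).

Definition metro_area : {set G} := cover (metro_zones M).

Definition included (W : seq G) : bool := all [in metro_area] W.

(* m = z(W) for some x-y-path W = x :: s included in the metropolitan zone. *)
Definition metro_zone_count (x y : G) (m : nat) : Prop :=
  exists s : seq G, [/\ path (@adj G) x s, last x s = y,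
    included (x :: s) & zone_count Z (x :: s) = m].

Lemma metro_zone_count_ex (x y : {v : G | v \in metro_area}) :
  exists m, `[< metro_zone_count (val x) (val y) m >].
Proof.
case: x y => [x xM] [y yM] /=.
have /connectP[s sP ->] := metro_connected xM yM.
exists (zone_count Z (x :: s)); apply/asboolP; exists s; split=> //.
  by apply: sub_path sP => u v /= /andP[].
rewrite /included /= xM /=; elim: s x {xM} sP => //= v s IHs x.
by case/andP=> /andP[/andP[_ vM] _] /IHs ->; rewrite vM.
Qed.

Definition metro_dist (x y : {v : G | v \in metro_area}) : nat :=
  ex_minn (metro_zone_count_ex x y).

Definition Dmax : nat :=
  \max_(x : {v : G | v \in metro_area})
    \max_(y : {v : G | v \in metro_area}) metro_dist x y.

(* Passengers travelling inside the metropolitan zone cross as few zones as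
   possible; only such paths are subject to the no-stopover property. *)
Definition considered (W : seq G) : Prop :=
  forall i j, 1 <= i -> i <= j -> j <= size W ->
    included (subpath W i j) -> zone_count Z (subpath W i j) <= Dmax.

End Metropolitan.

Local Open Scope ring_scope.

(* Price functions have domain {1, 2, ...}: the value at 0 is never used, as
   zone_count is positive. *)
Definition basic_zone_tariff (R : realType) (G : ptn) (Z : zone_partition G)
    (P : nat -> R) (W : seq G) : R :=
  P (zone_count Z W).

Definition metro_tariff (R : realType) (G : ptn) (Z : zone_partition G)
    (M : metro_zone Z) (P : nat -> R) (PM : R) (W : seq G) : R :=
  if included M W then PM else P (zone_count Z W).

(* The predicate C selects the paths under consideration. *)
Definition no_stopover (R : realType) (G : ptn) (C : seq G -> Prop)
    (p : seq G -> R) : Prop :=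
  forall W : seq G, is_path W -> C W -> (3 <= size W)%N ->
  forall i : nat, (2 <= i)%N -> (i <= (size W).-1)%N ->
    p (subpath W 1 (size W)) <=
      p (subpath W 1 i) + p (subpath W i (size W)).

(* Main.v *)
Require Import Defs.
From mathcomp Require Import all_boot all_order all_algebra.
From mathcomp Require Import boolp reals.
From mathcomp Require Import zify.
Import Order.TTheory GRing.Theory Num.Theory.
Local Open Scope ring_scope.

(** Cutting a path at one of its nodes splits the zone count up to the node
    that is counted twice: z(W) + 1 = z(W1) + z(W2) ([zone_count_split]).

    Sufficiency.  If W is included in the metropolitan zone, so are W1 and W2,
    and the claim is PM <= PM + PM.  Otherwise W1 or W2 leaves the zone:
    either both parts leave it, and all fares are those of the basic tariff, or
    exactly one part is included.  In the latter case the included part has at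
    most d zones, because the path is a considered one, whereas the other part
    starts or ends inside the metropolitan zone and leaves it, so it crosses a
    zone border and has k + 1 zones with k >= 1 ([zone_count_ge2]).  Hence
    z(W) <= d + k, and monotonicity reduces the claim to
    P(d + k) <= PM + P(k + 1).

    Necessity.  For d = 1 the inequality only says 0 <= PM.  For d >= 2 the
    inequality is the no-stopover property of one trip: in the line network
    with d + k nodes, each a zone of its own, whose first d nodes form the
    metropolitan zone, travel from end to end with a stopover at the d-th node
    ([line_Dmax] shows that this network has the required distance d).  The
    stopover is an inner node of the trip only if d >= 2. *)

(** * Zone counts along paths *)

Section ZoneCount.
Context {G : ptn} (Z : zone_partition G).
Implicit Types (x y : G) (s t W : seq G).

Lemma zone_count1 x : zone_count Z [:: x] = 1%N.
Proof. by rewrite /zone_count big_nil. Qed.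

Lemma zone_count_cons x y s :
  zone_count Z [:: x, y & s] = (border_weight Z x y + zone_count Z (y :: s))%N.
Proof. by rewrite /zone_count /= big_cons /= addnCA. Qed.

Lemma zone_count_cat s y t :
  (zone_count Z (rcons s y) + zone_count Z (y :: t))%N
  = (zone_count Z (s ++ y :: t)).+1.
Proof.
elim: s => [|x [|x' s] IHs] /=; first by rewrite zone_count1.
  by rewrite !zone_count_cons zone_count1; lia.
by move: IHs; rewrite !zone_count_cons /=; lia.
Qed.

Lemma subpath_size W i : subpath W i (size W) = drop i.-1 W.
Proof. by rewrite /subpath take_size. Qed.

Lemma subpath1 W i : subpath W 1 i = take i W.
Proof. by rewrite /subpath drop0. Qed.

Lemma split_at W i : (1 <= i)%N -> (i <= size W)%N ->
  exists s y t, [/\ W = s ++ y :: t, take i W = rcons s y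
                  & drop i.-1 W = y :: t].
Proof.
case: i => // i _ iW; have x0 : G by case: W iW => // x.
exists (take i W), (nth x0 W i), (drop i.+1 W).
by rewrite -drop_nth // cat_take_drop -take_nth.
Qed.

Lemma zone_count_split W i : (1 <= i)%N -> (i <= size W)%N ->
  (zone_count Z (take i W) + zone_count Z (drop i.-1 W))%N
  = (zone_count Z W).+1.
Proof.
move=> i1 iW; have [s [y [t [-> -> ->]]]] := split_at _ _ i1 iW.
exact: zone_count_cat.
Qed.

Variable M : metro_zone Z.

(** The metropolitan area is a union of zones, so crossing its boundary means
    crossing a zone border. *)
Lemma same_zone_metro x y :
  border_weight Z x y = 0%N -> (x \in metro_area M) = (y \in metro_area M).
Proof.
move=> /eqP; rewrite /border_weight eqb0 negbK => /eqP xy.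
have tI : trivIset (zones Z) by case/and3P: (zonesP Z).
have cZ : cover (zones Z) = [set: G] by case/and3P: (zonesP Z) => /eqP.
(* a metropolitan zone containing u is the block of u, hence contains any v
   with the same block *)
suff H u v : pblock Z u = pblock Z v -> u \in metro_area M ->
    v \in metro_area M.
  by apply/idP/idP; apply: H.
move=> uv /bigcupP[B BM uB]; apply/bigcupP; exists B => //.
rewrite -(def_pblock tI (subsetP (metro_sub M) _ BM) uB) uv.
by rewrite mem_pblock cZ inE.
Qed.

Lemma zone_count_le1 x s : (zone_count Z (x :: s) <= 1)%N ->
  {in x :: s, forall y, (y \in metro_area M) = (x \in metro_area M)}.
Proof.
elim: s x => [|x' s IHs] x; first by move=> _ y; rewrite inE => /eqP->.
rewrite zone_count_cons => zle y.
have z1 : (1 <= zone_count Z (x' :: s))%N by [].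
have xx' : (x \in metro_area M) = (x' \in metro_area M).
  by apply: same_zone_metro; lia.
rewrite inE => /predU1P[-> //|ys]; rewrite xx'; apply: IHs ys.
by lia.
Qed.

Lemma zone_count_ge2 W y : y \in W -> y \in metro_area M ->
  ~~ included M W -> (2 <= zone_count Z W)%N.
Proof.
case: W => // x s yW yM; apply: contraR; rewrite -leqNgt => z1.
apply/allP=> v vW.
by rewrite (zone_count_le1 _ _ z1 v vW) -(zone_count_le1 _ _ z1 y yW).
Qed.

Lemma included_split W i : (1 <= i)%N -> (i <= size W)%N ->
  included M W = included M (take i W) && included M (drop i.-1 W).
Proof.
move=> i1 iW; have [s [y [t [-> -> ->]]]] := split_at _ _ i1 iW.
rewrite /included all_cat all_rcons /=.
by case: (y \in _); rewrite ?andbF.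
Qed.

End ZoneCount.

(** * Sufficiency *)

Section Sufficiency.
Variables (R : realType) (P : nat -> R) (PM : R).
Hypothesis P_increasing :
  forall k l : nat, (1 <= k)%N -> (k <= l)%N -> P k <= P l.
Hypothesis PM_ge0 : 0 <= PM.

(** The mixed case: z1 zones inside the metropolitan zone are charged PM and
    the z2 zones of the other part are charged by P. *)
Lemma price_mixed (d z z1 z2 : nat) :
    (forall k : nat, (1 <= k)%N -> P (d + k)%N <= PM + P (k + 1)%N) ->
    (1 <= z)%N -> (z1 <= d)%N -> (2 <= z2)%N -> (z1 + z2 = z.+1)%N ->
  P z <= PM + P z2.
Proof.
move=> cond z_gt0 z1d z2_ge2 zE.
have := cond z2.-1; rewrite addn1 prednK ?(ltnW z2_ge2) // => Hk.
apply: le_trans (Hk _); last by lia.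
by apply: P_increasing; lia.
Qed.

Lemma metro_tariff_no_stopover (G : ptn) (Z : zone_partition G)
    (M : metro_zone Z) :
    no_stopover (fun _ : seq G => True) (basic_zone_tariff Z P) ->
    (forall k : nat, (1 <= k)%N -> P (Dmax M + k)%N <= PM + P (k + 1)%N) ->
  no_stopover (considered M) (metro_tariff M P PM).
Proof.
move=> basic cond W Wpath Wcons W3 i i2 iW.
have i1 : (1 <= i)%N by lia.
have iW' : (i <= size W)%N by lia.
have := basic W Wpath I W3 i i2 iW.
have := Wcons 1%N i isT i1 iW'; have := Wcons i (size W) i1 iW' (leqnn _).
rewrite /basic_zone_tariff /metro_tariff !subpath1 !subpath_size take_size.
have zE := zone_count_split Z W i i1 iW'.
rewrite (included_split Z M W i i1 iW').
have [s [y [t [_ W1E W2E]]]] := split_at W i i1 iW'.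
have yW1 : y \in take i W by rewrite W1E mem_rcons mem_head.
have yW2 : y \in drop i.-1 W by rewrite W2E mem_head.
case: (boolP (included M (take i W))) => inc1;
  case: (boolP (included M (drop i.-1 W))) => inc2 //= z2d z1d _.
- by rewrite lerDl.
- have yM := allP inc1 y yW1.
  apply: (price_mixed _ _ (zone_count Z (take i W)) _ cond) => //.
    exact: z1d.
  exact: zone_count_ge2 yW2 yM inc2.
- have yM := allP inc2 y yW2.
  rewrite addrC.
  apply: (price_mixed _ _ (zone_count Z (drop i.-1 W)) _ cond) => //.
  + exact: z2d.
  + exact: zone_count_ge2 yW1 yM inc1.
  + by rewrite addnC.
Qed.

End Sufficiency.

(** * Networks in which every node is a zone *)

Section Discrete.
Variable G : ptn.

Definition singletons (A : {set G}) : {set {set G}} := [set [set x] | x in A].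

Lemma cover_singletons A : cover (singletons A) = A.
Proof.
apply/setP=> x; apply/bigcupP/idP => [[B /imsetP[y yA ->]]|xA].
  by rewrite inE => /eqP->.
by exists [set x]; rewrite ?set11 // imset_f.
Qed.

Lemma trivIset_singletons A : trivIset (singletons A).
Proof.
apply/trivIsetP=> B C /imsetP[x _ ->] /imsetP[y _ ->] xy.
by rewrite disjoints1 inE; apply: contraNneq xy => ->.
Qed.

Lemma singletons_partition : partition (singletons [set: G]) [set: G].
Proof.
apply/and3P; split; first by rewrite cover_singletons.
  exact: trivIset_singletons.
by apply/imsetP=> -[x _ /setP/(_ x)]; rewrite !inE eqxx.
Qed.

Definition discrete_zones := ZonePartition singletons_partition.

Lemma border_weight_discrete x y : border_weight discrete_zones x y = (x != y).
Proof.
have pb v : pblock (singletons [set: G]) v = [set v].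
  apply: def_pblock; rewrite ?set11 //; first exact: trivIset_singletons.
  by rewrite imset_f.
by rewrite /border_weight /= !pb (inj_eq set1_inj).
Qed.

Lemma zone_count_discrete x s :
  path (@adj G) x s -> zone_count discrete_zones (x :: s) = (size s).+1.
Proof.
elim: s x => [|y s IHs] x /=; first by rewrite zone_count1.
case/andP=> xy /IHs zE; rewrite zone_count_cons zE border_weight_discrete.
by case: eqP xy => // ->; rewrite adj_irr.
Qed.

Lemma zone_count_discrete_sorted W :
  is_path W -> zone_count discrete_zones W = size W.
Proof. by case: W => // x s /andP[_ /=]; apply: zone_count_discrete. Qed.

End Discrete.

(** * The line network *)

Section Line.
Variable n : nat.

Definition line_adj : rel 'I_n := fun i j => (i.+1 == j) || (j.+1 == i).

Lemma line_adj_sym : symmetric line_adj.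
Proof. by move=> i j; rewrite /line_adj orbC. Qed.

Lemma line_adj_irr : irreflexive line_adj.
Proof. by move=> i; rewrite /line_adj; lia. Qed.

Lemma line_connect (d : nat) (x y : 'I_n) : (x < d)%N -> (y < d)%N ->
  connect [rel u v : 'I_n | ((u < d)%N && (v < d)%N) && line_adj u v] x y.
Proof.
set e := (X in connect X).
have esym : connect_sym e.
  by apply: sym_connect_sym => u v; rewrite /e /= line_adj_sym (andbC (u < d)%N).
(* by symmetry it suffices to walk up from the smaller of the two nodes *)
wlog: x y / (x <= y)%N => [hw xd yd|].
  by case: (leqP x y) => xy; [|rewrite esym]; apply: hw => //; apply: ltnW.
case: y => y yn /=; elim: y yn => [|y IHy] yn xy xd yd.
  suff -> : x = Ordinal yn by [].
  by apply: val_inj => /=; lia.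
move: xy; rewrite leq_eqVlt => /predU1P[xy|xy].
  suff -> : x = Ordinal yn by [].
  exact: val_inj.
have yn' : (y < n)%N by lia.
apply: connect_trans (IHy yn' xy xd (ltnW yd)) _.
by apply: connect1; rewrite /e /= (ltnW yd) yd /line_adj /= eqxx.
Qed.

Lemma line_adj_connected x y : connect line_adj x y.
Proof.
apply: connect_sub (line_connect n x y (ltn_ord x) (ltn_ord y)).
by move=> u v /= /andP[_ uv]; apply: connect1.
Qed.

Definition line : ptn := Ptn line_adj_sym line_adj_irr line_adj_connected.

Definition line_walk : seq line := enum 'I_n.

Lemma size_line_walk : size line_walk = n.
Proof. exact: size_enum_ord. Qed.

Lemma line_walk_sorted : sorted (@adj line) line_walk.
Proof.
pose e (i j : nat) := (i.+1 == j) || (j.+1 == i).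
suff : sorted e (map val (enum 'I_n)) by rewrite sorted_map.
rewrite val_enum_ord; case: n => // m /=.
by elim: m 0%N => //= m IHm k; rewrite IHm /e eqxx.
Qed.

(** One step raises the position by at most one, so a walk from x to y has at
    least y - x steps. *)
Lemma line_path_size (x : line) s : path (@adj line) x s ->
  ((last x s : 'I_n) <= x + size s)%N.
Proof.
elim: s x => [|y s IHs] x /=; first by rewrite addn0.
case/andP=> xy /IHs /leq_trans-> //; rewrite -addSnnS leq_add2r.
by case/orP: xy => /eqP; [move=> <- | move/eqP; lia].
Qed.

Variable d : nat.
Hypotheses (d_gt0 : (0 < d)%N) (d_le_n : (d <= n)%N).

Definition line_segment : {set line} := [set x : 'I_n | (x < d)%N].

Lemma card_line_segment : #|line_segment| = d.
Proof.
rewrite cardsE -sum1_card.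
by rewrite (big_ord_narrow d_le_n) /= sum1_card card_ord.
Qed.

Lemma line_segment_sub : singletons line line_segment \subset
  zones (discrete_zones line).
Proof. by apply: imsetS; apply: subsetT. Qed.

Lemma line_segment_neq0 : cover (singletons line line_segment) != set0.
Proof. by rewrite cover_singletons -card_gt0 card_line_segment. Qed.

Lemma line_segment_connected x y :
  x \in cover (singletons line line_segment) ->
  y \in cover (singletons line line_segment) ->
  connect [rel u v in cover (singletons line line_segment) | @adj line u v] x y.
Proof.
rewrite !cover_singletons !inE => xd yd.
apply: connect_sub (line_connect d x y xd yd) => u v /= uv.
by apply: connect1; rewrite /= !inE.
Qed.

Definition line_metro : metro_zone (discrete_zones line) :=
  MetroZone line_segment_sub line_segment_neq0 line_segment_connected.

Lemma line_metro_area : metro_area line_metro = line_segment.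
Proof. exact: cover_singletons. Qed.

Lemma included_uniq_size W :
  included line_metro W -> uniq W -> (size W <= d)%N.
Proof.
rewrite /included line_metro_area => /allP incW Wu.
by rewrite -card_line_segment cardE uniq_leq_size // => x /incW; rewrite mem_enum.
Qed.

(** Any two nodes of the segment are joined by a path without repeated nodes,
    which visits at most the d nodes of the segment; between the two ends of
    the segment no path is shorter. *)
Lemma line_Dmax : Dmax line_metro = d.
Proof.
apply/eqP; rewrite eqn_leq; apply/andP; split.
  apply/bigmax_leqP=> x _; apply/bigmax_leqP=> y _.
  rewrite /metro_dist; case: ex_minnP => m _ min_m.
  case: x y min_m => [x xM] [y yM] /= min_m.
  have /connectP[s sP yE] := metro_connected xM yM.
  case/shortenP: sP yE => s' sP Wu _ yE.
  have inc : included line_metro (x :: s').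
    rewrite /included /= xM /=; move: (x) sP; elim: (s') => //= v q IHq u.
    by case/andP=> /andP[/andP[_ vM] _] /IHq ->; rewrite andbT.
  have sadj : path (@adj line) x s'.
    by apply: sub_path sP => u v /= /andP[].
  apply: leq_trans (included_uniq_size _ inc Wu).
  apply: min_m; apply/asboolP; exists s'; split=> //.
  exact: zone_count_discrete.
have n_gt0 : (0 < n)%N by apply: leq_trans d_le_n.
have dn : (d.-1 < n)%N by rewrite prednK.
have xM : (Ordinal n_gt0 : line) \in metro_area line_metro.
  by rewrite line_metro_area inE.
have yM : (Ordinal dn : line) \in metro_area line_metro.
  by rewrite line_metro_area inE /= prednK.
pose xend : {v : line | v \in metro_area line_metro} :=
  exist _ (Ordinal n_gt0 : line) xM.
pose yend : {v : line | v \in metro_area line_metro} :=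
  exist _ (Ordinal dn : line) yM.
apply: (bigop.bigmax_sup xend) => //; apply: (bigop.bigmax_sup yend) => //.
rewrite /metro_dist; case: ex_minnP => m /asboolP[s [sP lastE _ <-]] _.
rewrite zone_count_discrete //.
have := line_path_size _ _ sP; rewrite lastE /=; lia.
Qed.

Lemma line_walk_considered : considered line_metro line_walk.
Proof.
move=> i j i1 ij jn inc; rewrite line_Dmax zone_count_discrete_sorted.
  by apply: included_uniq_size => //; rewrite drop_uniq // take_uniq // enum_uniq.
apply/andP; split.
  by rewrite -size_eq0 size_drop size_takel //; lia.
by rewrite drop_sorted // take_sorted // line_walk_sorted.
Qed.

Lemma included_line_prefix : included line_metro (take d line_walk).
Proof.
rewrite /included line_metro_area; apply/allP=> x xW; rewrite inE.
have : val x \in map val (take d (enum 'I_n)) by rewrite map_f.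
rewrite map_take val_enum_ord take_iota mem_iota => /andP[_ /leq_trans-> //].
exact: geq_minl.
Qed.

(** The last node of the line lies outside the segment, and every nonempty
    final part of the walk contains it. *)
Lemma included_line_suffix j : (d < n)%N -> (j < n)%N ->
  ~~ included line_metro (drop j line_walk).
Proof.
move=> dn jn; have n1 : (n.-1 < n)%N by lia.
apply/allPn; exists (Ordinal n1 : line); last first.
  by rewrite line_metro_area inE /=; lia.
rewrite -(mem_map val_inj) map_drop val_enum_ord drop_iota mem_iota /=; lia.
Qed.

End Line.

(** * The characterisation *)

Theorem theorem26 (R : realType) (P : nat -> R) (PM : R) (d : nat)
    (P_ge0 : forall k : nat, (1 <= k)%N -> 0 <= P k)
    (P_increasing : forall k l : nat, (1 <= k)%N -> (k <= l)%N -> P k <= P l)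
    (P_basic : forall (G : ptn) (Z : zone_partition G),
      no_stopover (fun _ : seq G => True) (basic_zone_tariff Z P))
    (PM_ge0 : 0 <= PM) (d_ge1 : (1 <= d)%N) :
  (forall (G : ptn) (Z : zone_partition G) (M : metro_zone Z),
     Dmax M = d -> no_stopover (considered M) (metro_tariff M P PM))
  <-> (forall k : nat, (1 <= k)%N -> P (d + k)%N <= PM + P (k + 1)%N).
Proof.
split=> [metro k k1|cond G Z M DM]; last first.
  by apply: metro_tariff_no_stopover; rewrite ?DM.
have [d1|d2] := leqP d 1.
  have -> : d = 1%N by apply/eqP; rewrite eqn_leq d1.
  by rewrite addnC lerDr.
have dn : (d < d + k)%N by lia.
pose W := line_walk (d + k); pose M := line_metro _ _ d_ge1 (ltnW dn).
have sW : size W = (d + k)%N := size_line_walk _.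
have Wsorted : sorted (@adj (line (d + k))) W := line_walk_sorted _.
have Wpath : is_path W by rewrite /is_path -size_eq0 sW Wsorted andbT; lia.
have W3 : (3 <= size W)%N by rewrite sW; lia.
have dW : (d <= (size W).-1)%N by rewrite sW; lia.
have := metro _ _ M (line_Dmax _ _ _ _) W Wpath
  (line_walk_considered _ _ _ _) W3 d d2 dW.
rewrite /metro_tariff !subpath1 !subpath_size take_size included_line_prefix.
have /negbTE-> : ~~ included M (drop d.-1 W).
  by apply: included_line_suffix; lia.
have /negbTE-> : ~~ included M W.
  by rewrite -[W]drop0; apply: included_line_suffix; lia.
rewrite !zone_count_discrete_sorted ?size_drop ?sW //.
  by have -> : (d + k - d.-1 = k + 1)%N by lia.
rewrite /is_path drop_sorted // andbT -size_eq0 size_drop sW; lia.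
Qed.
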